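(* Let $S$ and $A$ be finite sets (the state and action spaces), and let $Q_\theta : S\times A\to\mathbb{R}$ be a (possibly nonlinear) function approximator that is differentiable in its parameters $\theta\in\mathbb{R}^d$. Consider Q-learning with this function approximator based on the update $$\theta'=\theta+\alpha g,\qquad g = \mathbb{E}_{(s,a)\sim\rho}\big[\big(\mathcal{T}^*Q_\theta(s,a)-Q_\theta(s,a)\big)\nabla_\theta Q_\theta(s,a)\big],$$ where $\alpha$ is the learning rate, $\rho$ is a probability distribution on $S\times A$ (the distribution of experience in the replay buffer at the time of the update), and $\mathcal{T}^*$ is the optimal Bellman operator. Represent Q functions as vectors in $\mathbb{R}^{|S||A|}$, indexed by state-action pairs. Then the $Q$-values before and after an update are related by $$Q_{\theta'} = Q_\theta+\alpha K_\theta D_\rho\big(\mathcal{T}^*Q_\theta-Q_\theta\big)+\mathcal{O}\big(\|\alpha g\|^2\big),$$ where $K_\theta$ is the $|S||A|\times|S||A|$ matrix with entries $k_\theta(\bar s,\bar a,s,a)=\nabla_\theta Q_\theta(\bar s,\bar a)^T\nabla_\theta Q_\theta(s,a)$, and $D_\rho$ is the diagonal matrix with diagonal entries $\rho(s,a)$.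
   Context: The setting is a Markov decision process with state set $S$, action set $A$, transition kernel $P$, reward function $R(s,a,s')$, and discount factor $\gamma\in(0,1)$. The optimal Bellman operator $\mathcal{T}^*$ acts on functions $Q:S\times A\to\mathbb{R}$ by $$\mathcal{T}^*Q(s,a)=\mathbb{E}_{s'\sim P(\cdot\mid s,a)}\Big[R(s,a,s')+\gamma\max_{a'\in A}Q(s',a')\Big].$$ The remainder $\mathcal{O}(\|\alpha g\|^2)=\mathcal{O}(\|\theta'-\theta\|^2)$ is the remainder of the first-order Taylor expansion of $Q$ around $\theta$, evaluated at $\theta'$: $Q_{\theta'}(\bar s,\bar a)=Q_\theta(\bar s,\bar a)+\nabla_\theta Q_\theta(\bar s,\bar a)^T(\theta'-\theta)+\mathcal{O}(\|\theta'-\theta\|^2)$.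
   Formalization: Differentiability alone does not give a quadratic remainder, so it is also assumed that, at the given θ, the first-order Taylor expansion of each Q_θ(s,a) in θ has remainder O(‖θ'−θ‖²). *)

(* Defs.v *)
From HB Require Import structures.
From mathcomp Require Import all_boot all_order all_algebra.
From mathcomp Require Import all_classical all_reals all_analysis.

Set Implicit Arguments.
Unset Strict Implicit.
Unset Printing Implicit Defensive.

Import Order.TTheory GRing.Theory Num.Theory.
Import numFieldNormedType.Exports.
Local Open Scope classical_set_scope.
Local Open Scope ring_scope.

Definition is_distr (R : realType) (T : finType) (p : T -> R) : Prop :=
  (forall x, 0 <= p x) /\ \sum_(x : T) p x = 1.

Definition expect (R : realType) (T : finType) (V : lmodType R)
    (p : T -> R) (f : T -> V) : V :=
  \sum_(x : T) p x *: f x.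

Record mdp (R : realType) (S A : finType) := Mdp {
  trans : S -> A -> S -> R;
  reward : S -> A -> S -> R;
  discount : R;
  trans_distr : forall s a, is_distr (trans s a);
  discount_itv : 0 < discount < 1
}.

(* The maximum over the nonempty finite set [A]; the value does not depend on
   the element [a0], which only witnesses that [A] is nonempty. *)
Definition max_act (R : realType) (A : finType) (a0 : A) (f : A -> R) : R :=
  \big[Num.max/f a0]_(a : A) f a.

Definition opt_bellman (R : realType) (S A : finType) (a0 : A)
    (M : mdp R S A) (q : S * A -> R) : S * A -> R :=
  fun sa => expect (trans M sa.1 sa.2) (fun s' =>
    (reward M sa.1 sa.2 s' + discount M * max_act a0 (fun a' => q (s', a')))
      : R^o).

Definition gradient (R : realType) (d : nat) (f : 'cV[R]_d -> R)
    (theta : 'cV[R]_d) : 'cV[R]_d :=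
  \col_i 'D_(delta_mx i 0) f theta.

Definition q_grad (R : realType) (S A : finType) (d : nat)
    (Q : 'cV[R]_d -> S * A -> R) (theta : 'cV[R]_d) (sa : S * A) : 'cV[R]_d :=
  gradient (fun th => Q th sa) theta.

Definition update_dir (R : realType) (S A : finType) (a0 : A) (d : nat)
    (M : mdp R S A) (rho : S * A -> R) (Q : 'cV[R]_d -> S * A -> R)
    (theta : 'cV[R]_d) : 'cV[R]_d :=
  expect rho (fun sa =>
    (opt_bellman a0 M (Q theta) sa - Q theta sa) *: q_grad Q theta sa).

(* Vectors and matrices indexed by [S * A] use the enumeration of that type;
   [#|{: S * A}|] is [#|S| * #|A|]. *)
Definition qvec (R : realType) (S A : finType) (q : S * A -> R) :
    'cV[R]_#|{: S * A}| :=
  \col_i q (enum_val i).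

Definition kernel_mx (R : realType) (S A : finType) (d : nat)
    (Q : 'cV[R]_d -> S * A -> R) (theta : 'cV[R]_d) : 'M[R]_#|{: S * A}| :=
  \matrix_(i, j)
    ((q_grad Q theta (enum_val i))^T *m q_grad Q theta (enum_val j)) 0 0.

Definition distr_mx (R : realType) (S A : finType) (rho : S * A -> R) :
    'M[R]_#|{: S * A}| :=
  diag_mx (qvec rho)^T.

(* Main.v *)
(* The remainder is the vector of first-order Taylor remainders of the
   coordinates [Q^~ sa]: finitely many bounds are uniform, and along
   [alpha *: g] the linear term is [alpha K D (T Q - Q)] because [g] is a
   [rho]-weighted sum of gradients. *)
Require Import Defs.
From HB Require Import structures.
From mathcomp Require Import all_boot all_order all_algebra.
From mathcomp Require Import all_classical all_reals all_analysis.

Set Implicit Arguments.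
Unset Strict Implicit.
Unset Printing Implicit Defensive.

Import Order.TTheory GRing.Theory Num.Theory.
Import numFieldNormedType.Exports.
Local Open Scope classical_set_scope.
Local Open Scope ring_scope.

(** The matrix norm is the largest absolute value of an entry, and finitely many index pairs can
    share one constant and one member of the filter. *)
Lemma eqO_mx (R : realFieldType) (T : Type) (W : normedModType R)
    (m n : nat) (F : filter_on T) (f : T -> 'M[R]_(m, n)) (g : T -> W) :
  (forall i j, (fun h => f h i j) =O_F g) -> f =O_F g.
Proof.
move=> fg; apply/eqOP.
have : \forall k \near +oo, forall ij : 'I_m * 'I_n,
    \forall h \near F, `|f h ij.1 ij.2| <= k * `|g h|.
  by apply: filter_forall => ij; exact: (eqO_bigO (fg ij.1 ij.2)).
(* [0 <= k] is required because the maximum defining the norm starts from [0]. *)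
apply: filterS2 (nbhs_pinfty_ge (real0 R)) => k k0 /filter_forall.
apply: filterS => h fgh; rewrite [leLHS]/Num.norm/= mx_normrE.
by apply: bigmax_le => [|ij _ //]; rewrite mulr_ge0.
Qed.

(** In each row the gradient at the row index is a common left factor, so by linearity it leaves the
    sum over state-action pairs; what remains is a [rho]-expectation shaped like the update
    direction. *)
Lemma kernel_distr_mulmx (R : realType) (S A : finType) (d : nat)
    (Q : 'cV[R]_d -> S * A -> R) (theta : 'cV[R]_d) (rho u v : S * A -> R) :
  kernel_mx Q theta *m distr_mx rho *m (qvec u - qvec v) =
  qvec (fun sa => ((q_grad Q theta sa)^T *m
    expect rho (fun sa' => (u sa' - v sa') *: q_grad Q theta sa')) 0 0).
Proof.
apply/colP => i; rewrite /distr_mx mul_mx_diag [RHS]mxE mulmx_sumr summxE.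
rewrite [RHS](reindex (@enum_val (S * A)%type predT)) /=; last first.
  exact/onW_bij/enum_val_bij.
rewrite mxE; apply: eq_bigr => j _.
rewrite -!scalemxAr !mxE.
by rewrite -mulrA mulrC -mulrA.
Qed.

Theorem theorem1 (R : realType) (S A : finType) (a0 : A) (d : nat)
    (Q : 'cV[R]_d -> S * A -> R)
    (Q_diff : forall (theta : 'cV[R]_d) (sa : S * A),
       differentiable (fun th => Q th sa) theta)
    (theta : 'cV[R]_d)
    (Q_taylor : forall sa : S * A,
       (fun h : 'cV[R]_d =>
          Q (theta + h) sa - Q theta sa - ((q_grad Q theta sa)^T *m h) 0 0)
       =O_ (0 : 'cV[R]_d) (fun h : 'cV[R]_d => `|h| ^+ 2)) :
  exists2 r : 'cV[R]_d -> 'cV[R]_#|{: S * A}|,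
    r =O_ (0 : 'cV[R]_d) (fun h : 'cV[R]_d => `|h| ^+ 2) &
    forall (M : mdp R S A) (rho : S * A -> R) (alpha : R),
      is_distr rho ->
      let g := update_dir a0 M rho Q theta in
      let theta' := theta + alpha *: g in
      qvec (Q theta') =
        qvec (Q theta)
        + alpha *: (kernel_mx Q theta *m distr_mx rho
                    *m (qvec (opt_bellman a0 M (Q theta)) - qvec (Q theta)))
        + r (alpha *: g).
Proof.
(* [e] depends only on [Q] and [theta], so one remainder serves every [M], [rho] and [alpha]. *)
pose e (sa : S * A) (h : 'cV[R]_d) : R :=
  Q (theta + h) sa - Q theta sa - ((q_grad Q theta sa)^T *m h) 0 0.
exists (fun h => qvec (e^~ h)).
  by apply: eqO_mx => i j; under eq_fun do rewrite mxE; exact: Q_taylor.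
move=> M rho alpha _ g theta'; rewrite kernel_distr_mulmx -/g.
(* Once [alpha] is pulled out of the linear term of [e], that term cancels the kernel term exactly,
   for [alpha] of any size. *)
apply/colP => i; rewrite !mxE /e -scalemxAr !mxE.
by rewrite -addrA [X in _ + X]addrC subrK addrC subrK.
Qed.
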